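(* Let $X$ be a compact space. The following are equivalent: (1) There exists an uncountable family of pairwise disjoint open subsets of $X$. (2) $C_p(X)$ contains a copy of $(c_{00}(\Gamma))_p$ for some uncountable set $\Gamma$. (3) $C_p(X)$ contains a closed copy of $(c_0(\Gamma))_p$ for some uncountable set $\Gamma$. (4) The Banach space $C(X)$ contains a copy of the Banach space $c_0(\Gamma)$ for some uncountable set $\Gamma$. (5) $C_p(X)$ contains a compact non-separable subset.
   Context: Compact spaces are Hausdorff. $C(X)$ is the space of continuous real-valued functions on $X$, regarded as a Banach space with the sup-norm; $C_p(X)$ is the same vector space endowed with the topology of pointwise convergence. For a set $\Gamma$, $c_0(\Gamma)$ is the space of all $(t_\gamma)\in\mathbb{R}^\Gamma$ such that $\{\gamma\in\Gamma:|t_\gamma|\ge\varepsilon\}$ is finite for every $\varepsilon>0$, a Banach space with the sup-norm; $c_{00}(\Gamma)$ is the space of all $(t_\gamma)\in\mathbb{R}^\Gamma$ with $t_\gamma\neq 0$ for only finitely many $\gamma$. The subscript $p$ in $(c_0(\Gamma))_p$ and $(c_{00}(\Gamma))_p$ means that these vector spaces carry the topology inherited from the product $\mathbb{R}^\Gamma$. A copy of a topological vector space $G$ in a topological vector space $E$ is a vector subspace of $E$ linearly homeomorphic to $G$; a closed copy is a copy that is a closed subset of $E$. *)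

(* Defs.v *)
From HB Require Import structures.
From mathcomp Require Import all_boot all_order all_algebra.
From mathcomp Require Import all_classical all_reals all_analysis.
From mathcomp Require Import ring.

Set Implicit Arguments.
Unset Strict Implicit.
Unset Printing Implicit Defensive.

Import Order.TTheory GRing.Theory Num.Theory.
Import numFieldNormedType.Exports.

Local Open Scope classical_set_scope.
Local Open Scope ring_scope.

Section pointwise_topology.
Context (R : realType) (I : Type) (P : {pred I -> R}).

(* The function space V with the topology inherited from the product R^I. *)
Definition pointwise (V : subLmodType (in_mem^~ (mem P))) : Type :=
  initial_topology (\val : V -> {ptws I -> R}).

Variable V : subLmodType (in_mem^~ (mem P)).

HB.instance Definition _ := GRing.Lmodule.on (pointwise V).
HB.instance Definition _ :=
  Topological.copy (pointwise V) (initial_topology (\val : V -> {ptws I -> R})).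

Lemma continuous_to_pointwise (T : topologicalType) (f : T -> pointwise V) :
  (forall i, continuous (fun t => \val (f t) i)) -> continuous f.
Proof.
move=> cf; apply: continuous_comp_initial => x; apply/cvg_sup => i.
by apply: (@continuous_comp_initial _ T R (fun g : I -> R => g i)); exact: cf.
Qed.

Let proj_ptws_continuous i : continuous (fun g : {ptws I -> R} => g i).
Proof.
move=> g A Ag; have /cvg_sup/(_ i) : nbhs g --> g by [].
apply; exact: (@initial_continuous _ R (fun g : I -> R => g i) g A Ag).
Qed.

Lemma pointwise_eval_continuous i :
  continuous (fun v : pointwise V => (\val v : I -> R) i).
Proof.
move=> v; apply: (@continuous_comp (pointwise V) {ptws I -> R} R \val
  (fun g => g i)).
  exact: initial_continuous.
exact: proj_ptws_continuous.
Qed.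

Let pointwise_add_continuous :
  continuous (fun x : pointwise V * pointwise V => x.1 + x.2).
Proof.
apply: continuous_to_pointwise => i x.
under eq_fun do rewrite raddfD.
apply: cvgD.
- apply: (@continuous_comp _ (pointwise V) R fst (fun v => \val v i)).
    exact: cvg_fst.
  exact: pointwise_eval_continuous.
- apply: (@continuous_comp _ (pointwise V) R snd (fun v => \val v i)).
    exact: cvg_snd.
  exact: pointwise_eval_continuous.
Qed.

Let pointwise_scale_continuous :
  continuous (fun z : R^o * pointwise V => z.1 *: z.2).
Proof.
apply: continuous_to_pointwise => i x.
under eq_fun do rewrite linearZ.
apply: cvgM; first exact: cvg_fst.
apply: (@continuous_comp _ (pointwise V) R snd (fun v => \val v i)).
  exact: cvg_snd.
exact: pointwise_eval_continuous.
Qed.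

HB.instance Definition _ :=
  PreTopologicalNmodule_isTopologicalNmodule.Build (pointwise V)
    pointwise_add_continuous.
HB.instance Definition _ :=
  TopologicalNmodule_isTopologicalLmodule.Build R (pointwise V)
    pointwise_scale_continuous.

End pointwise_topology.

Section sup_norm.
Context (R : realType) (I : Type) (P : {pred I -> R}).

(* sup set0 = 0, so this is also correct when I is empty. *)
Definition sup_norm (f : I -> R) : R := sup (range (fun i => `|f i|)).

Definition sup_bounded (V : subLmodType (in_mem^~ (mem P))) :=
  forall v : V, has_ubound (range (fun i => `|(\val v : I -> R) i|)).

(* P is closed under uniform limits. *)
Definition sup_closed :=
  forall f : I -> R, (forall e, 0 < e ->
    exists2 g : I -> R, g \in P & forall i, `|f i - g i| <= e) -> f \in P.

(* V with the norm sup_norm; the two proofs are recorded in the type because the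
   Banach space structure declared below depends on them. *)
Definition sup_normed (V : subLmodType (in_mem^~ (mem P)))
  (bV : sup_bounded V) (cP : sup_closed) : Type := V.

Context (V : subLmodType (in_mem^~ (mem P))) (bV : sup_bounded V).
Context (cP : sup_closed).

Local Notation W := (sup_normed bV cP).

HB.instance Definition _ := GRing.Lmodule.on W.

Let norm (v : W) : R := sup_norm (\val (v : V)).

Lemma le_sup_norm (v : W) i : `|(\val (v : V) : I -> R) i| <= norm v.
Proof. by apply: ub_le_sup => //; exists i. Qed.

Lemma sup_norm_le (v : W) e : 0 <= e ->
  (forall i, `|(\val (v : V) : I -> R) i| <= e) -> norm v <= e.
Proof.
move=> e0 ve; rewrite /norm /sup_norm.
have [->|/set0P ne] := eqVneq (range (fun i => `|(\val (v : V) : I -> R) i|)) set0.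
  by rewrite sup0.
by apply: ge_sup => // _ [i _ <-].
Qed.

Let norm_ge0 (v : W) : 0 <= norm v.
Proof.
rewrite /norm /sup_norm.
have [->|/set0P[_ [i _ _]]] :=
    eqVneq (range (fun i => `|(\val (v : V) : I -> R) i|)) set0.
  by rewrite sup0.
exact: le_trans (le_sup_norm v i).
Qed.

Let ler_normD (u v : W) : norm (u + v) <= norm u + norm v.
Proof.
apply: sup_norm_le => [|i]; first by rewrite addr_ge0.
by rewrite raddfD (le_trans (ler_normD _ _))// lerD// le_sup_norm.
Qed.

Let le_normZ (a : R) (v : W) : norm (a *: v) <= `|a| * norm v.
Proof.
apply: sup_norm_le => [|i]; first by rewrite mulr_ge0.
by rewrite linearZ /= normrM ler_wpM2l// le_sup_norm.
Qed.

Let normZ (a : R) (v : W) : norm (a *: v) = `|a| * norm v.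
Proof.
apply/eqP; rewrite eq_le le_normZ /=.
have [->|a0] := eqVneq a 0; first by rewrite normr0 mul0r.
rewrite -ler_pdivlMl ?normr_gt0// -normfV.
by have := le_normZ a^-1 (a *: v); rewrite scalerA mulVf// scale1r.
Qed.

Let norm0_eq0 (v : W) : norm v = 0 -> v = 0.
Proof.
move=> v0; apply: val_inj; rewrite raddf0; apply/funext => i.
by apply/eqP; rewrite -normr_le0 -v0 le_sup_norm.
Qed.

HB.instance Definition _ :=
  Lmodule_isNormed.Build R W ler_normD normZ norm0_eq0.

Lemma sup_normedE (v : W) : `|v| = sup_norm (\val (v : V)).
Proof. by []. Qed.

Let eval_norm_le (v : W) i : `|(\val (v : V) : I -> R) i| <= `|v|.
Proof. exact: le_sup_norm. Qed.

Let complete (F : set_system W) : ProperFilter F -> cauchy F -> cvg F.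
Proof.
move=> FF /cauchyP Fc.
have {}Fc e : 0 < e -> exists u : W, F (ball u e) by exact: Fc.
pose ev i (v : W) : R := (\val (v : V) : I -> R) i.
have evB i u v : ev i u - ev i v = ev i (u - v) by rewrite /ev raddfB.
have evc i : cvg (ev i @ F).
  apply: cauchy_cvg; apply/cauchyP => e e0.
  have [u Fu] := Fc e e0; exists (ev i u).
  change (F (ev i @^-1` ball (ev i u) e)); apply: filterS Fu => v /=.
  rewrite -!ball_normE /= => uv; rewrite -/(ev i u) -/(ev i v) evB.
  exact: le_lt_trans (eval_norm_le _ i) uv.
pose f i : R := lim (ev i @ F).
have close e (u : W) : F (ball u e) -> forall i, `|f i - ev i u| <= e.
  move=> Fu i.
  have fu : (fun v => `|ev i v - ev i u|) @ F --> `|f i - ev i u|.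
    by apply: cvg_norm; apply: cvgB; [exact: evc|exact: cvg_cst].
  rewrite -(cvg_lim _ fu)//; apply: limr_le; first by apply/cvg_ex; eexists; exact: fu.
  apply: filterS Fu => v; rewrite -ball_normE /= distrC => uv.
  rewrite -/(ev i u) -/(ev i v) evB.
  by apply/ltW/(le_lt_trans (eval_norm_le _ i)).
have fP : f \in P.
  apply: cP => e e0; have [u Fu] := Fc e e0.
  by exists (\val (u : V)); [exact: valP|exact: close].
pose g : W := Sub f fP.
have gE : \val (g : V) = f by exact: SubK.
apply/cvg_ex; exists g; apply/cvgrPdist_le => e e0.
have [u Fu] := Fc (e / 2) (divr_gt0 e0 (ltr0Sn R 1)).
apply: filterS (Fu) => v; rewrite -ball_normE /= => uv.
have gu : `|g - u| <= e / 2.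
  apply: sup_norm_le => [|i]; first by rewrite ltW ?divr_gt0.
  by rewrite -[_ i]/(ev i (g - u)) -evB /ev gE; exact: close.
by rewrite (splitr e) -(subrKA u) (le_trans (Num.Theory.ler_normD _ _))// lerD// ltW.
Qed.

HB.instance Definition _ := Uniform_isComplete.Build W complete.

End sup_norm.

Section continuous_functions.
Context (R : realType) (X : topologicalType).

Definition continuous_pred : {pred X -> R} :=
  mem [set f : X -> R | continuous f].

Lemma continuous_submod_closed : submod_closed continuous_pred.
Proof.
split=> [|a f g]; rewrite !inE /=.
  by move=> x; exact: cvg_cst.
move=> cf cg x; apply: cvgD; last exact: cg.
by apply: cvgM; [exact: cvg_cst|exact: cf].
Qed.

HB.instance Definition _ := GRing.isSubmodClosed.Build R (X -> R)
  continuous_pred continuous_submod_closed.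

Record cfun := CFun { cfun_val :> X -> R; _ : cfun_val \in continuous_pred }.

HB.instance Definition _ := [isSub for cfun_val].
HB.instance Definition _ := [Choice of cfun by <:].
HB.instance Definition _ := [SubChoice_isSubLmodule of cfun by <:].


Lemma cfun_sup_bounded : compact [set: X] -> sup_bounded cfun.
Proof.
move=> cX f; have cf : continuous f by have := valP f; rewrite inE.
have : compact (range f) by apply: continuous_compact => //; exact: continuous_subspaceT.
move=> /compact_bounded[M [_ /(_ (M + 1))]]; rewrite ltrDl ltr01 => /(_ isT) fM.
by exists (M + 1) => _ [x _ <-]; apply: fM; exists x.
Qed.

Lemma continuous_sup_closed : sup_closed continuous_pred.
Proof.
move=> f lf; rewrite inE /= => x; apply/cvgrPdist_le => e e0.
have e3 : 0 < e / 3 by rewrite divr_gt0.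
have [g] := lf _ e3; rewrite inE /= => cg fg.
have /cvgrPdist_le/(_ _ e3) := cg x; apply: filterS => y gxy.
have -> : f x - f y = (f x - g x) + (g x - g y) - (f y - g y) by ring.
have -> : e = e / 3 + e / 3 + e / 3 by field.
rewrite (le_trans (ler_normB _ _))// lerD//.
by rewrite (le_trans (ler_normD _ _))// lerD.
Qed.

End continuous_functions.

Definition Cp (R : realType) (X : topologicalType) : topologicalLmodType R :=
  pointwise (cfun R X).

Definition C_sup (R : realType) (X : topologicalType)
    (cX : compact [set: X]) : completeNormedModType R :=
  sup_normed (cfun_sup_bounded (R := R) cX) (@continuous_sup_closed R X).

Section c0.
Context (R : realType) (Gamma : Type).

Definition c0_pred : {pred Gamma -> R} := mem [set t : Gamma -> R |
  forall e, 0 < e -> finite_set [set i | e <= `|t i|]].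

Definition c00_pred : {pred Gamma -> R} :=
  mem [set t : Gamma -> R | finite_set [set i | t i != 0]].

Lemma c0_submod_closed : submod_closed c0_pred.
Proof.
split=> [|a t u]; rewrite !inE /=.
  move=> e e0; rewrite (_ : [set _ | _] = set0)//.
  by apply/seteqP; split => // i /=; rewrite normr0 leNgt e0.
move=> ct cu e e0.
have a0 : 0 < `|a| + 1 by rewrite ltr_wpDl.
pose d := e / 2 / (`|a| + 1).
have d0 : 0 < d by rewrite !divr_gt0.
have e2 : 0 < e / 2 by rewrite divr_gt0.
apply: (@sub_finite_set _ _ ([set i | d <= `|t i|] `|` [set i | e / 2 <= `|u i|])).
  move=> i /=; apply: contraPP => /not_orP[/negP + /negP].
  rewrite -!ltNge => td ue; apply/negP; rewrite -ltNge.
  rewrite (le_lt_trans (ler_normD _ _))// (splitr e) ler_ltD// normrM.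
  rewrite (le_trans (ler_wpM2l _ (ltW td)))// /d mulrCA ger_pMr//.
  by rewrite ler_pdivrMr// mul1r lerDl.
by rewrite finite_setU; split; [exact: ct|exact: cu].
Qed.

HB.instance Definition _ := GRing.isSubmodClosed.Build R (Gamma -> R)
  c0_pred c0_submod_closed.

Lemma c00_submod_closed : submod_closed c00_pred.
Proof.
split=> [|a t u]; rewrite !inE /=.
  rewrite (_ : [set _ | _] = set0)//.
  by apply/seteqP; split => // i /=; rewrite eqxx.
move=> ct cu.
apply: (@sub_finite_set _ _ ([set i | t i != 0] `|` [set i | u i != 0])).
  move=> i /=; apply: contraPP => /not_orP[/negP + /negP].
  rewrite !negbK => /eqP t0 /eqP u0; apply/negP; rewrite negbK.
  by rewrite [X in X == _](_ : _ = a * t i + u i)// t0 u0 mulr0 addr0.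
by rewrite finite_setU; split.
Qed.

HB.instance Definition _ := GRing.isSubmodClosed.Build R (Gamma -> R)
  c00_pred c00_submod_closed.

Record c0 := C0 { c0_val :> Gamma -> R; _ : c0_val \in c0_pred }.

HB.instance Definition _ := [isSub for c0_val].
HB.instance Definition _ := [Choice of c0 by <:].
HB.instance Definition _ := [SubChoice_isSubLmodule of c0 by <:].

Record c00 := C00 { c00_val :> Gamma -> R; _ : c00_val \in c00_pred }.

HB.instance Definition _ := [isSub for c00_val].
HB.instance Definition _ := [Choice of c00 by <:].
HB.instance Definition _ := [SubChoice_isSubLmodule of c00 by <:].

Lemma c0_sup_bounded : sup_bounded c0.
Proof.
move=> t; have : (t : Gamma -> R) \in c0_pred by exact: valP.
rewrite inE /= => /(_ 1 ltr01) /(finite_image (fun i => `|t i|)).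
move=> /finite_seqP[A At].
have A0 r : r \in A -> 0 <= r.
  by move=> rA; have : [set` A] r by []; rewrite -At => -[i _ <-].
exists (1 + \sum_(r <- A) r) => _ [i _ <-] /=.
have S0 : 0 <= \sum_(r <- A) r by rewrite big_seq sumr_ge0.
have [t1|t1] := leP 1 `|t i|; last by rewrite (le_trans (ltW t1))// lerDl.
have iA : `|t i| \in A by have : [set` A] `|t i| by rewrite -At; exists i.
rewrite (big_rem `|t i|)//= addrCA lerDl addr_ge0// big_seq sumr_ge0// => r.
by move=> /mem_rem/A0.
Qed.

Lemma c0_sup_closed : sup_closed c0_pred.
Proof.
move=> t lt; rewrite inE /= => e e0; have e2 : 0 < e / 2 by rewrite divr_gt0.
have [u] := lt _ e2; rewrite inE /= => /(_ _ e2) + tu.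
apply: sub_finite_set => i /= et.
rewrite -(lerD2l (e / 2)) -splitr (le_trans et)// -(subrK (u i) (t i)).
by rewrite (le_trans (ler_normD _ _))// lerD2r.
Qed.

Definition c0_p : topologicalLmodType R := pointwise c0.

Definition c00_p : topologicalLmodType R := pointwise c00.

Definition c0_sup : completeNormedModType R :=
  sup_normed c0_sup_bounded c0_sup_closed.

End c0.

Section copies.
Context (R : realType) (E G : topologicalLmodType R).

(* The linear homeomorphism G -> S is f; its inverse is the restriction to S of
   g, whose values outside S are irrelevant. *)
Definition is_copy (S : set E) : Prop :=
  submod_closed (mem S) /\
  exists (f : {linear G -> E}) (g : E -> G),
    [/\ range f = S, cancel f g, continuous f & {within S, continuous g}].

Definition contains_copy : Prop := exists S : set E, is_copy S.

Definition contains_closed_copy : Prop :=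
  exists S : set E, closed S /\ is_copy S.

End copies.
Arguments contains_copy {R} E G.
Arguments contains_closed_copy {R} E G.

Definition uncountable (T : Type) (A : set T) : Prop := ~ countable A.

(* Separability of A in its subspace topology: a subset D of A is dense in A
   exactly when A is included in the closure of D in T. *)
Definition separable_set (T : topologicalType) (A : set T) : Prop :=
  exists D : set T, [/\ countable D, D `<=` A & A `<=` closure D].

(* Main.v *)
From HB Require Import structures.
Require Import Defs.
From mathcomp Require Import finmap.
From mathcomp Require Import all_boot all_order all_algebra.
From mathcomp Require Import all_classical all_reals all_analysis.
From mathcomp Require Import lra.

Set Implicit Arguments.
Unset Strict Implicit.
Unset Printing Implicit Defensive.

Import Order.TTheory GRing.Theory Num.Theory.
Import numFieldNormedType.Exports.

Local Open Scope classical_set_scope.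
Local Open Scope ring_scope.

(** Each of the three kinds of copies gives a compact non-separable set: the
    images [f_g] of the unit vectors are nonzero continuous functions such that
    at every point [x] and for every [e > 0] only finitely many of them satisfy
    [e <= |f_g x|].  In the pointwise copies this is the continuity of the
    embedding; in a sup-norm copy it holds because signed sums of [n] unit
    vectors have norm 1, so that a bounded operator [T] cannot send more than
    [|T| / e] of them above [e] at [x].  Such a family converges to 0 along the
    cofinite filter, hence together with 0 it is compact in [C_p(X)], and each
    [f_g] is isolated in it, so that an uncountable family makes it
    non-separable ([null_family_compact_nonseparable]).

    Conversely, disjoint nonempty open sets [U_g] carry bump functions [f_g]
    peaking at points [p_g], and [t |-> \sum_g t_g f_g] maps [c_0] and [c_00]
    into [C(X)].  It is isometric for the sup-norms and a homeomorphism onto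
    its range for the pointwise topologies, the inverse being
    [h |-> (h (p_g))_g].  On [c_0] its range is pointwise closed: it is the set
    of all [h] with [h = \sum_g h(p_g) f_g], because [(h (p_g))_g] must then be
    in [c_0]; otherwise infinitely many [p_g] with [e <= |h(p_g)|] accumulate at
    some [z], where [h] does not vanish, and the set [U_g] around [z] contains
    only one of these points ([bump_sum_fixpoint_c0]).

    The core is the passage from a compact non-separable set to an uncountable
    disjoint family: if every disjoint family of open sets is countable, then
    every compact [K] in [C_p(X)] is separable.  It rests on a form of Namioka's
    theorem on separate and joint continuity
    ([exists_small_oscillation]): every nonempty open set contains a nonempty
    open [V] on which all members of [K] vary by at most [e] simultaneously.
    For each [e = 1/(n+1)], a maximal disjoint family of such sets [V] is
    countable and has a dense union.  Choosing one point in each [V] for all [n]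
    gives a countable set [D] such that two members of [K] which agree on [D]
    are equal.  The compact set [K] is thus determined by countably many
    coordinates, and finite nets for finitely many coordinates at a time form
    a countable dense subset. *)

(** * Cluster points and null families *)

Lemma filter_bigcap_finite (T I : Type) (F : set_system T) (A : set I)
    (B : I -> set T) : Filter F -> finite_set A ->
  (forall i, A i -> F (B i)) -> F (\bigcap_(i in A) B i).
Proof.
move=> FF fA FB.
have /finite_fsetP[D AD] := fA : finite_set (A : set {classic I}).
rewrite AD.
by apply: (@filter_bigI T {classic I}) => i iD; apply: FB; rewrite AD.
Qed.

(** This replaces the extraction of convergent subsequences, which need not exist
    in a compact space: a cluster point still inherits every closed condition
    that holds eventually along the sequence. *)
Lemma compact_seq_cluster (T : topologicalType) (K : set T) (u : nat -> T) :
  compact K -> (forall n, K (u n)) ->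
  exists2 p, K p & forall C, closed C -> (\forall n \near \oo, C (u n)) -> C p.
Proof.
move=> cK Ku; have [|p [Kp cp]] := cK (u @ \oo) _.
  by exists 0%N => // n _ /=; exact: Ku.
exists p => // C /closure_id CE uC; rewrite CE.
by move: cp; rewrite clusterE; exact.
Qed.

(** The step relation may depend on the stage, so that precisions tending to 0 can
    be prescribed along the sequence. *)
Lemma dependent_choice_nat (S : Type) (s0 : S) (P : nat -> S -> S -> Prop) :
  (forall n s, exists t, P n s t) ->
  exists2 u : nat -> S, u 0%N = s0 & forall n, P n (u n) (u n.+1).
Proof.
move=> Pex; pose f n := projT1 (choice (Pex n)).
exists (fix u n := if n is m.+1 then f m (u m) else s0) => // n.
exact: (projT2 (choice (Pex n))).
Qed.

(** A filter on the union that avoids a neighborhood of [l] lives on the finitely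
    many points of the family outside that neighborhood. *)
Lemma compact_null_family (T : topologicalType) (Gamma : Type) (f : Gamma -> T)
    (l : T) : (forall B, nbhs l B -> cofinite_set (f @^-1` B)) ->
  compact (l |` range f).
Proof.
move=> fl F FF Fr; have [cl|] := pselect (cluster F l).
  by exists l; split => //; left.
rewrite /cluster /= /meets => /existsNP[A] /existsNP[B].
move=> /not_implyP[FA] /not_implyP[lB] AB0.
have fS := fl _ lB.
have [|p [[i iS <-] clp]] := finite_compact (finite_image f fS) FF.
  apply: filterS (filterI FA Fr) => p [Ap [pl|[i _ ip]]].
    by case: AB0; exists p; split => //; rewrite pl; exact: nbhs_singleton.
  by exists i => // Bi; apply: AB0; exists p; split => //; rewrite -ip.
by exists (f i); split => //; right; exists i.
Qed.

(** * The topology of pointwise convergence *)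

Section pointwise_facts.
Context (R : realType) (I : Type) (P : {pred I -> R}).
Context (V : subLmodType (in_mem^~ (mem P))).

Lemma cvg_to_pointwise (T : Type) (F : set_system T) (f : T -> pointwise V)
    (v : pointwise V) : Filter F ->
  (forall i, (fun t => (\val (f t) : I -> R) i) @ F --> (\val v : I -> R) i) ->
  f @ F --> v.
Proof.
move=> FF fv A [B [[C oC <-] Cv CA]].
apply: (@filterS _ (f @ F) _ _ _ CA).
suff : (fun t => \val (f t) : {ptws I -> R}) @ F --> (\val v : {ptws I -> R}).
  by move=> /(_ C); apply; exact: open_nbhs_nbhs.
apply/cvg_sup => i D [E [[G oG <-] Gv GD]].
apply: filterS GD _; apply: (fv i); exact: open_nbhs_nbhs.
Qed.

Lemma pointwise_hausdorff : hausdorff_space (pointwise V).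
Proof.
move=> v w vw; apply: val_inj; apply/funext => i; apply: Rhausdorff => A B Av Bw.
have [u [Au Bu]] := vw _ _ (pointwise_eval_continuous Av)
  (pointwise_eval_continuous Bw).
by exists ((\val u : I -> R) i).
Qed.

Lemma near_pointwise_lt (v : pointwise V) (A : set I) (e : R) :
  finite_set A -> 0 < e ->
  \forall w \near v, forall i, A i -> `|(\val v : I -> R) i - (\val w : I -> R) i| < e.
Proof.
move=> fA e0; apply: (filter_bigcap_finite (F := nbhs v)
  (B := fun i => [set w : pointwise V | `| \val v i - \val w i| < e])) => // i _.
have := @pointwise_eval_continuous _ _ _ V i v.
by move=> /cvgrPdist_lt/(_ _ e0).
Qed.

(** The image of [K] in the finite power of [R] indexed by [A] is totally bounded. *)
Lemma pointwise_compact_net (K : set (pointwise V)) (A : set I) (e : R) :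
  compact K -> finite_set A -> 0 < e ->
  exists N : set (pointwise V), [/\ finite_set N, N `<=` K &
    forall k, K k -> exists2 h, N h &
      forall i, A i -> `|(\val k : I -> R) i - (\val h : I -> R) i| <= e].
Proof.
move=> cK fA e0.
pose near_on (k : pointwise V) := [set h : pointwise V |
  forall i, A i -> `|(\val k : I -> R) i - (\val h : I -> R) i| < e].
(* 0 serves as the base point in the covering criterion for compactness *)
pose T : ptopologicalType :=
  HB.pack (pointwise V) (isPointed.Build (pointwise V) 0).
have : @compact T K by [].
rewrite compact_cover => /(_ _ K (fun k => (near_on k)°)) [k _|k Kk|N NK KN].
- exact: open_interior.
- by exists k => //; exact: near_pointwise_lt.
exists [set` N]; split => // [k /NK/set_mem//|k Kk].
have [h Nh /interior_subset kh] := KN _ Kk.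
by exists h => // i /kh/ltW; rewrite distrC.
Qed.

(** The hypothesis is convergence to 0 of each coordinate along the cofinite
    filter, and the topology of [pointwise V] is initial for the coordinates. *)
Lemma pointwise_null_family (Gamma : Type) (f : Gamma -> pointwise V) :
  (forall i e, 0 < e -> finite_set [set g | e <= `|(\val (f g) : I -> R) i|]) ->
  forall B, nbhs (0 : pointwise V) B -> cofinite_set (f @^-1` B).
Proof.
move=> f0; pose F : set_system Gamma := [set A | cofinite_set A].
have FF : Filter F.
  split; first exact: cofinite_setT.
    by move=> A B FA FB; rewrite [F _]cofinite_setI.
  by move=> A B AB; exact: sub_cofinite_set.
suff : f @ F --> (0 : pointwise V) by [].
apply: cvg_to_pointwise => i; rewrite raddf0.
apply/cvgrPdist_lt => e /(f0 i); apply: sub_finite_set => g /= /negP.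
by rewrite add0r normrN -leNgt.
Qed.

End pointwise_facts.

(** * Open sets of small oscillation for a compact set of functions *)

Section compact_in_Cp.
Context (R : realType) (X : topologicalType).
Implicit Types (k h : cfun R X) (U V W : set X).

Lemma cfun_continuous k : continuous k.
Proof. by have := valP k; rewrite inE. Qed.

Lemma cfun0E x : (0 : cfun R X) x = 0.
Proof.
have : \val (0 : cfun R X) = 0 by rewrite raddf0.
by move/(congr1 (fun u => u x)).
Qed.

Lemma Cp_eval_continuous x : continuous (fun k : Cp R X => (k : cfun R X) x).
Proof. exact: (@pointwise_eval_continuous _ _ _ (cfun R X)). Qed.

Lemma Cp_dist_continuous (k : cfun R X) x :
  continuous (fun h : Cp R X => `|k x - (h : cfun R X) x|).
Proof.
move=> h; apply: (@continuous_comp (Cp R X) R R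
  (fun h => (h : cfun R X) x) (fun y => `|k x - y|)).
  exact: Cp_eval_continuous.
by apply: cvg_norm; apply: cvgB; [exact: cvg_cst|exact: cvg_id].
Qed.

Lemma Cp_pair_dist_continuous x :
  continuous (fun p : Cp R X * Cp R X =>
    `|(p.1 : cfun R X) x - (p.2 : cfun R X) x|).
Proof.
move=> p; apply: cvg_norm; apply: cvgB.
- apply: (@continuous_comp _ (Cp R X) R fst (fun k => (k : cfun R X) x)).
    exact: cvg_fst.
  exact: Cp_eval_continuous.
- apply: (@continuous_comp _ (Cp R X) R snd (fun k => (k : cfun R X) x)).
    exact: cvg_snd.
  exact: Cp_eval_continuous.
Qed.

Lemma cfun_dist_continuous k h : continuous (fun x => `|k x - h x|).
Proof. by move=> x; apply: cvg_norm; apply: cvgB; exact: cfun_continuous. Qed.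

Definition equi_oscillation (K : set (Cp R X)) (d : R) (V : set X) : Prop :=
  forall k, K k -> forall x y, V x -> V y -> `|k x - k y| <= d.

Hypotheses (cX : compact [set: X]) (hX : hausdorff_space X).

Lemma open_shrink (U : set X) x : open U -> U x ->
  exists V, [/\ open V, V x & closure V `<=` U].
Proof.
move=> oU Ux; have [W Wx WU] := @compact_regular X x setT hX cX filterT U
  (open_nbhs_nbhs (conj oU Ux)).
exists W°; split; first exact: open_interior.
  exact: Wx.
by apply: subset_trans WU; apply: closureS; exact: interior_subset.
Qed.

Section oscillation.
Variables (K : set (Cp R X)) (cK : compact K).

(** One step of the construction for Namioka's theorem.  If no pair of members
    of [K] that nearly agree on [A] were more than [d] apart anywhere in [U], a
    finite net of [K] for the coordinates in [A] would approximate [K] within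
    [d] uniformly on [U].  Finitely many continuous functions all vary by less
    than [d] on some neighborhood of a point of [U], so all members of [K] would
    vary by at most [3 * d] there. *)
Lemma separating_pair (U0 : set X) (d r : R) (A U : set X) : 0 < d -> 0 < r ->
  (forall V, open V -> V !=set0 -> V `<=` U0 -> ~ equi_oscillation K (3 * d) V) ->
  finite_set A -> open U -> U !=set0 -> U `<=` U0 ->
  exists k h : cfun R X, exists V : set X,
    [/\ K k /\ K h, (forall x, A x -> `|k x - h x| <= r),
        open V /\ V !=set0, closure V `<=` U & forall x, V x -> d <= `|k x - h x|].
Proof.
move=> d0 r0 noV fA oU [u0 Uu0] UU0; apply: contrapT => nopair.
have close k h : K k -> K h -> (forall x, A x -> `|k x - h x| <= r) ->
    forall u, U u -> `|k u - h u| <= d.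
  move=> Kk Kh kh u Uu; rewrite leNgt; apply/negP => dkh; apply: nopair.
  have oW : open (U `&` [set x | d < `|k x - h x|]).
    apply: openI => //; apply: (@open_comp _ _ _ [set y | d < y]).
      by move=> x _; exact: cfun_dist_continuous.
    exact: open_gt.
  have [V [oV Vu VW]] := open_shrink oW (conj Uu dkh).
  exists k, h, V; split => //.
  - by split => //; exists u.
  - by move=> x /VW[].
  - by move=> x Vx; have /VW[_ /= /ltW] := subset_closure Vx.
have [N [fN NK KN]] := pointwise_compact_net cK fA r0.
have d2 : 0 < d / 2 by rewrite divr_gt0.
have : nbhs u0 (U `&` [set x | forall h, N h ->
    `|(h : cfun R X) u0 - (h : cfun R X) x| < d / 2]).
  apply: filterI; first exact: open_nbhs_nbhs.
  apply: (filter_bigcap_finite (F := nbhs u0)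
    (B := fun h : cfun R X => [set x | `|h u0 - h x| < d / 2])) => // h _.
  by have /cvgrPdist_lt/(_ _ d2) := @cfun_continuous h u0.
rewrite nbhsE => -[V [oV Vu0] VN].
apply: (noV V oV).
- by exists u0.
- by move=> x /VN[/UU0].
move=> k Kk x y Vx Vy.
have [h Nh kh] := KN _ Kk.
have [Ux /(_ _ Nh) hx] := VN _ Vx; have [Uy /(_ _ Nh) hy] := VN _ Vy.
have kx := close _ _ Kk (NK _ Nh) kh _ Ux.
have ky := close _ _ Kk (NK _ Nh) kh _ Uy.
move: hx hy kx ky; rewrite !ltr_norml !ler_norml.
by do 4 move=> /andP[? ?]; apply/andP; split; lra.
Qed.

(** Otherwise [separating_pair] yields, inductively, pairs [k n], [h n] in [K]
    at distance at least [d] all over a shrinking sequence of open sets [W n],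
    and points [x n] of the [W n] such that [k n] and [h n] nearly agree at all
    [x i] with [i < n].  Let [(k', h')] and [z] be cluster points of the pairs and
    of the points.  Then [k'] and [h'] agree at every [x n], hence at [z] by
    continuity; but [z] lies in every [W n], so they are at least [d] apart at
    [z]. *)
Lemma exists_small_oscillation (U : set X) (e : R) : 0 < e ->
  open U -> U !=set0 ->
  exists V, [/\ open V, V !=set0, V `<=` U & equi_oscillation K e V].
Proof.
move=> e0 oU U0; apply: contrapT => noV.
pose d := e / 3; have d0 : 0 < d by rewrite divr_gt0.
have {}noV V : open V -> V !=set0 -> V `<=` U -> ~ equi_oscillation K (3 * d) V.
  move=> oV V0 VU KV; apply: noV; exists V; split => //.
  by rewrite (_ : e = 3 * d)// /d; lra.
(* a state is the finite set of the points chosen so far and the current open set *)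
pose valid (s : set X * set X) :=
  [/\ finite_set s.1, open s.2, s.2 !=set0 & s.2 `<=` U].
pose step n (s t : {s | valid s}) := exists k h : cfun R X, exists x : X,
  [/\ K k /\ K h, (forall y, (sval s).1 y -> `|k y - h y| <= n.+1%:R^-1),
      (sval t).2 x /\ (sval t).1 = x |` (sval s).1,
      closure (sval t).2 `<=` (sval s).2
    & forall y, (sval t).2 y -> d <= `|k y - h y|].
have s0P : valid (set0, U) by split.
have stepP n s : exists t, step n s t.
  have [fA oW W0 WU] := svalP s.
  have [k [h [V [[Kk Kh] kh [oV [x Vx]] VW dkh]]]] :=
    @separating_pair U d n.+1%:R^-1 _ _ d0 (ltac:(by [])) noV fA oW W0 WU.
  have tP : valid (x |` (sval s).1, V).
    split => //=; [by rewrite finite_setU|by exists x|].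
    by apply: subset_trans WU; apply: subset_trans VW; exact: subset_closure.
  by exists (exist _ _ tP), k, h, x; split.
have [s _ sP] := dependent_choice_nat (exist _ _ s0P) stepP.
have [k /choice[h /choice[x]]] := choice sP.
move=> /all_and5[KK kh xs cs dkh].
pose A n := (sval (s n)).1; pose W n := (sval (s n)).2.
have AS n m : (n <= m)%N -> A n `<=` A m.
  apply: (homo_leq (r := fun B C => B `<=` C)) => [B|C B D BC CD y /BC/CD|i]//.
  by rewrite /A (xs i).2; exact: subsetUr.
have WS n m : (n <= m)%N -> W m `<=` W n.
  apply: (homo_leq (r := fun B C => C `<=` B)) => [B|C B D CB DC y /DC/CB|i]//.
  by apply: subset_trans (cs i); exact: subset_closure.
have xA n m : (n < m)%N -> A m (x n).
  by move=> /AS; apply; rewrite /A (xs n).2; left.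
have [|[k' h'] [Kk' Kh'] cl] := compact_seq_cluster
    (u := fun n => (k n, h n) : Cp R X * Cp R X) (compact_setX cK cK).
  by move=> n; split; [exact: (KK n).1|exact: (KK n).2].
have [z _ clz] := compact_seq_cluster (u := x) cX (fun=> I).
have xr n r : 0 < r -> `|(k' : cfun R X) (x n) - (h' : cfun R X) (x n)| <= r.
  move=> r0; apply: (cl [set p | `|(p.1 : cfun R X) (x n) - (p.2 : cfun R X) (x n)| <= r]).
    apply: (@preimage_closed _ _ _ [set y : R | y <= r]); last exact: closed_le.
    by move=> p _; exact: Cp_pair_dist_continuous.
  near=> m; rewrite /= (le_trans (kh m (x n) _))//.
    by apply: xA; near: m; exact: nbhs_infty_gt.
  by apply/ltW; near: m; exact: near_infty_natSinv_lt (PosNum r0).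
have zr r : 0 < r -> `|(k' : cfun R X) z - (h' : cfun R X) z| <= r.
  move=> r0; apply: (clz [set z | `|(k' : cfun R X) z - (h' : cfun R X) z| <= r]).
    apply: (@preimage_closed _ _ _ [set y : R | y <= r]); last exact: closed_le.
    by move=> p _; exact: cfun_dist_continuous.
  by apply: nearW => n; exact: xr.
have zW n : W n z.
  apply: cs; apply: clz; first exact: closed_closure.
  exists n => // m /= nm; apply: subset_closure; apply: (WS n.+1 m.+1) => //.
  exact: (xs m).1.
have : d <= `|(k' : cfun R X) z - (h' : cfun R X) z|.
  apply: (cl [set p | d <= `|(p.1 : cfun R X) z - (p.2 : cfun R X) z|]).
    apply: (@preimage_closed _ _ _ [set y : R | d <= y]); last exact: closed_ge.
    by move=> p _; exact: Cp_pair_dist_continuous.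
  by apply: nearW => n; apply: dkh; exact: zW.
by rewrite leNgt (le_lt_trans (zr (d / 2) _)) //; lra.
Unshelve. all: by end_near. Qed.

End oscillation.
End compact_in_Cp.

(** * Separability under the countable chain condition *)

Lemma countable_transversal (X : Type) (F : set (set X)) :
  countable F -> (forall V, F V -> V !=set0) ->
  exists2 D : set X, countable D & forall V, F V -> exists2 x, D x & V x.
Proof.
move=> cF F0.
have /choice[p pP] : forall V : set_type F, exists x, \val V x.
  by move=> V; apply: F0; exact: set_valP.
exists (range p) => [|V FV].
  apply: sub_countable (card_image_le _ _) _.
  by rewrite (eq_countable (card_setT F)).
by exists (p (SigSub (mem_set FV))) => //; exact: (pP (SigSub (mem_set FV))).
Qed.

(** A member of [B] inside [W] that missed the family could be added to it. *)
Lemma maximal_disjoint_meets (X : Type) (B F : set (set X)) (W : set X) :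
  maximal_disjoint_subcollection id F B ->
  W !=set0 -> (exists2 V, B V & V !=set0 /\ V `<=` W) ->
  exists2 V, F V & V `&` W !=set0.
Proof.
move=> [FB tF maxF] W0 [V BV [[v Vv] VW]]; apply: contrapT => FW.
have disj U : F U -> U `&` V = set0.
  move=> FU; apply/seteqP; split => // x [Ux /VW Wx].
  by apply: FW; exists U => //; exists x.
have nFV : ~ F V by move=> /disj; rewrite setIid => V0; rewrite V0 in Vv.
apply: (maxF (V |` F)).
- by split; [exact: subsetUr|move=> /(_ V) FV; apply/nFV/FV; left].
- by move=> U [->|/FB].
move=> U U' [->|FU] [->|FU'] //= [x [Ux U'x]].
- by have : (U' `&` V) x by []; rewrite disj.
- by have : (U `&` V) x by []; rewrite disj.
- by apply: tF => //; exists x.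
Qed.

Section separability.
Context (R : realType) (X : topologicalType).
Variables (K : set (Cp R X)) (cK : compact K).

(** For each [n], a maximal disjoint family of open sets on which [K] oscillates
    by at most [1/(n+1)] is countable and has a dense union.  If [k] and [h] agree
    at a point of each of these sets and differ by [e] somewhere, they differ by
    more than [2e/3] on an open set [W]; some set of the [n]-th family with
    [1/(n+1) < e/3] meets [W], where [k] and [h] differ by at most [2/(n+1)]. *)
Lemma ccc_countable_separating : compact [set: X] -> hausdorff_space X ->
  (forall F : set (set X), F `<=` open -> trivIset F id -> countable F) ->
  exists2 D : set X, countable D &
    forall k h : cfun R X, K k -> K h -> (forall x, D x -> k x = h x) -> k = h.
Proof.
move=> cX hX ccc.
pose B (n : nat) := [set V : set X |
  [/\ open V, V !=set0 & equi_oscillation K n.+1%:R^-1 V]].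
have /choice[F FP] : forall n, exists E,
    maximal_disjoint_subcollection id E (B n).
  by move=> n; have [E] := ex_maximal_disjoint_subcollection id (B n); exists E.
have /choice[D /all_and2[cD DP]] : forall n, exists D : set X, countable D /\
    forall V, F n V -> exists2 x, D x & V x.
  move=> n; have [FB tF _] := FP n.
  have [|V /FB[]//|D cD DF] := @countable_transversal X (F n).
    by apply: ccc => // V /FB[].
  by exists D.
exists (\bigcup_n D n).
  exact: bigcup_countable.
move=> k h Kk Kh kh; apply: val_inj; apply/funext => y; apply: contrapT => /eqP.
rewrite -subr_eq0 -normr_gt0 => khy.
set e := `|_| in khy; have e3 : 0 < e / 3 by rewrite divr_gt0.
have [n _ /(_ n (leqnn n)) /= ne] := near_infty_natSinv_lt (PosNum e3).
pose W := [set x | 2 * (e / 3) < `|k x - h x|].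
have oW : open W.
  apply: (@open_comp _ _ _ [set y | 2 * (e / 3) < y]); last exact: open_gt.
  by move=> x _; exact: cfun_dist_continuous.
have W0 : W !=set0 by exists y; rewrite /W /= -/e; lra.
have [|V FV [z [Vz Wz]]] := maximal_disjoint_meets (FP n) W0.
  have [//|V [oV V0 VW VK]] := @exists_small_oscillation R X cX hX K cK W n.+1%:R^-1 _ oW W0.
  by exists V.
have [FB _ _] := FP n; have [_ _ VK] := FB _ FV.
have [x Dx Vx] := DP _ _ FV.
have := VK _ Kk _ _ Vz Vx; have := VK _ Kh _ _ Vz Vx.
have -> : k x = h x by apply: kh; exists n.
move: Wz ne; rewrite /W /= !ler_norml.
move: n.+1%:R^-1 (e / 3) => q d + ? /andP[? ?] /andP[? ?].
rewrite ltr_normr => /orP[]; lra.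
Qed.

(** With [D = {d_0, d_1, ...}], the union over [n] of finite nets of [K] of
    precision [1/(n+1)] for the coordinates below [n] is dense: a sequence of net
    points ever closer to [k] has a cluster point in [K], which agrees with [k]
    on [D] and hence is [k]. *)
Lemma countable_separating_separable (D : set X) : countable D ->
  (forall k h : cfun R X, K k -> K h -> (forall x, D x -> k x = h x) -> k = h) ->
  separable_set K.
Proof.
move=> /countable_injP[c cinj] Dsep.
pose D_ n := [set x | D x /\ (c x < n)%N].
have fD n : finite_set (D_ n).
  have inj : {in D_ n &, injective c}.
    move=> x y; rewrite !inE => -[Dx _] [Dy _]; apply: cinj; exact: mem_set.
  have fc : finite_set (c @` D_ n).
    by apply: (sub_finite_set _ (finite_II n)) => _ [x [_ ?] <-].
  by rewrite -(eq_finite_set (inj_card_eq inj)).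
have inv_gt0 n : 0 < n.+1%:R^-1 :> R by [].
have /choice[N /all_and3[fN NK KN]] := fun n => pointwise_compact_net cK (fD n) (inv_gt0 n).
exists (\bigcup_n N n); split.
- by apply: bigcup_countable => // n _; exact: finite_set_countable.
- by move=> k [n _ /NK].
move=> k Kk.
have /choice[u /all_and2[uN ku]] : forall n, exists h, N n h /\
    forall x, D_ n x -> `|(k : cfun R X) x - (h : cfun R X) x| <= n.+1%:R^-1.
  by move=> n; have [h] := KN n _ Kk; exists h.
have [|k' Kk' cl] := compact_seq_cluster (u := u) cK.
  by move=> n; exact: NK (uN n).
suff <- : k' = k.
  apply: (cl (closure (\bigcup_n N n))); first exact: closed_closure.
  by apply: nearW => n; apply: subset_closure; exists n.
apply: Dsep => // x Dx; apply/eqP; rewrite eq_sym -subr_eq0 -normr_le0.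
apply/ler_addgt0Pl => e e0; rewrite addr0.
apply: (cl [set h | `|(k : cfun R X) x - (h : cfun R X) x| <= e]).
  apply: (@preimage_closed _ _ (fun h : Cp R X => `|(k : cfun R X) x - (h : cfun R X) x|)
    [set y : R | y <= e]); last exact: closed_le.
  by move=> h _; exact: Cp_dist_continuous.
near=> n; rewrite /= (le_trans (ku n x _))//.
  by split => //; near: n; exact: nbhs_infty_gt.
by apply/ltW; near: n; exact: near_infty_natSinv_lt (PosNum e0).
Unshelve. all: by end_near. Qed.

End separability.

(** * Null families of continuous functions *)

Section null_families.
Context (R : realType) (X : topologicalType) (Gamma : Type).
Variable (f : Gamma -> cfun R X).
Hypothesis f_neq0 : forall g, f g != 0.
Hypothesis f_null : forall x (e : R), 0 < e -> finite_set [set g | e <= `|f g x|].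

(** Where [f g] takes a value of modulus [2r > 0] at [x], only finitely many
    members of the family exceed [r] in modulus at [x]; hence [f g] is isolated
    in the compact set and belongs to every dense subset [D].  As each function
    occurs finitely often in the family, a countable [D] makes [Gamma]
    countable. *)
Lemma null_family_compact_nonseparable : uncountable [set: Gamma] ->
  exists K : set (Cp R X), compact K /\ ~ separable_set K.
Proof.
move=> ucG; exists (0 |` range (f : Gamma -> Cp R X)); split.
  by apply: compact_null_family; exact: (@pointwise_null_family _ _ _ (cfun R X)).
move=> [D [cD DK KD]]; apply: ucG.
have f_point g : exists x, f g x != 0.
  apply: contrapT => fg0; move/eqP: (f_neq0 g); apply; apply: val_inj.
  rewrite raddf0; apply/funext => x; apply: contrapT => /eqP fgx.
  by apply: fg0; exists x.
have fD g : D (f g).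
  have [x fgx] := f_point g; apply: contrapT => nD.
  pose r := `|f g x| / 2; have r0 : 0 < r by rewrite divr_gt0 ?normr_gt0.
  (* finite, without f g, and containing all of D that is r-close to f g at x *)
  pose E := D `&` (f @` [set g' | r <= `|f g' x|]).
  have cE : closed E.
    apply: (accessible_finite_set_closed).1; last first.
      by apply: finite_setIr; apply: finite_image; exact: f_null.
    by apply: hausdorff_accessible; exact: pointwise_hausdorff.
  have : closure D (f g) by apply: KD; right; exists g.
  have near_fg : nbhs (f g : Cp R X) (~` E `&`
      [set h | forall y, [set x] y -> `|f g y - (h : cfun R X) y| < r]).
    apply: filterI; last exact: (@near_pointwise_lt _ _ _ (cfun R X)).
    by apply: open_nbhs_nbhs; split; [exact: closed_openC|move=> [/nD]].
  move=> /(_ _ near_fg)[h [Dh [nEh /(_ x erefl) fgh]]]; apply: nEh; split => //.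
  have hr : r <= `|(h : cfun R X) x|.
    have := lerB_dist (f g x) (f g x - (h : cfun R X) x).
    rewrite opprB addrCA subrr addr0.
    have fr : `|f g x| = r + r by rewrite /r -splitr.
    by move: fgh; rewrite fr; lra.
  have [h0|[g' _ g'h]] := DK _ Dh; last by exists g' => //=; rewrite g'h.
  by move: hr; rewrite h0 cfun0E normr0 leNgt r0.
have -> : [set: Gamma] = \bigcup_(h in D) (f @^-1` [set h]).
  by apply/seteqP; split => // g _; exists (f g).
apply: bigcup_countable => // h Dh; apply: finite_set_countable.
have [->//|/set0P[g gh]] := eqVneq (f @^-1` [set h]) set0.
have [x fgx] := f_point g.
have fx0 : 0 < `|f g x| by rewrite normr_gt0.
apply: sub_finite_set (f_null x fx0) => g' /= g'h.
by rewrite g'h -gh.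
Qed.

End null_families.

(** * Images of unit vectors *)

Lemma indic1_null (R : realType) (Gamma : Type) (i : Gamma) (e : R) : 0 < e ->
  finite_set [set g | e <= `|\1_[set g] i : R|].
Proof.
move=> e0; apply: sub_finite_set (finite_set1 i) => g /=.
rewrite indicE; case: (boolP (i \in _)); first by rewrite inE => ->.
by rewrite normr0 leNgt e0.
Qed.

Section copies_to_compacts.
Context (R : realType) (X : topologicalType) (Gamma : Type).
Hypothesis uncountable_Gamma : uncountable [set: Gamma].

(** Continuity of [T] at 0 transports the coordinatewise convergence of the unit
    vectors to their images. *)
Lemma pointwise_copy_compact (P : {pred Gamma -> R})
    (V : subLmodType (in_mem^~ (mem P)))
    (T : {linear pointwise V -> Cp R X}) :
  (forall g : Gamma, (\1_[set g] : Gamma -> R) \in P) ->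
  injective T -> continuous T ->
  exists K : set (Cp R X), compact K /\ ~ separable_set K.
Proof.
move=> P1 injT cT; pose v g : pointwise V := (Sub (\1_[set g] : Gamma -> R) (P1 g) : V).
have vE g i : (\val (v g) : Gamma -> R) i = \1_[set g] i by rewrite SubK.
apply: (@null_family_compact_nonseparable R X Gamma (T \o v)) => //= [g|x e e0].
  apply/eqP => Tv0; have : v g = 0 by apply: injT; rewrite linear0.
  move=> /(congr1 (fun u : V => (\val u : Gamma -> R) g)).
  rewrite vE raddf0 indicE mem_set// => /eqP.
  by rewrite oner_eq0.
pose B := [set u : pointwise V | `|(T u : cfun R X) x| < e].
have B0 : nbhs (0 : pointwise V) B.
  have cTx : continuous (fun u : pointwise V => (T u : cfun R X) x).
    move=> u; apply: (@continuous_comp (pointwise V) (Cp R X) R T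
      (fun k => (k : cfun R X) x)); first exact: cT.
    exact: (@Cp_eval_continuous R X x (T u)).
  have Tx0 : (T 0 : cfun R X) x = 0 by rewrite linear0 cfun0E.
  have := cTx 0; rewrite /continuous_at Tx0.
  move=> /cvgr0Pnorm_lt/(_ _ e0); exact.
have : cofinite_set (v @^-1` B).
  apply: pointwise_null_family B0 => i d d0.
  under eq_set do rewrite vE; exact: indic1_null.
apply: sub_finite_set => g /= eT; apply/negP; by rewrite -leNgt.
Qed.

Lemma indic1_c0 (g : Gamma) : (\1_[set g] : Gamma -> R) \in @c0_pred R Gamma.
Proof.
rewrite inE /= => e e0; apply: sub_finite_set (finite_set1 g) => i /=.
rewrite indicE; case: (boolP (i \in _)); first by rewrite inE.
by rewrite normr0 leNgt e0.
Qed.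

Lemma indic1_c00 (g : Gamma) : (\1_[set g] : Gamma -> R) \in @c00_pred R Gamma.
Proof.
rewrite inE /=; apply: sub_finite_set (finite_set1 g) => i /=.
rewrite indicE; case: (boolP (i \in _)); first by rewrite inE.
by rewrite eqxx.
Qed.

(** If [e <= |T (v g) x|] for infinitely many [g], adding up [n] of the unit
    vectors [v g] with the signs of [T (v g) x] gives vectors of norm at most 1
    whose images are at least [n * e] at [x], against the boundedness of [T]. *)
Lemma sup_copy_compact (cX : compact [set: X])
    (T : {linear c0_sup R Gamma -> C_sup R cX}) :
  injective T -> continuous T ->
  exists K : set (Cp R X), compact K /\ ~ separable_set K.
Proof.
move=> injT cT; pose v g : c0 R Gamma := C0 (indic1_c0 g).
apply: (@null_family_compact_nonseparable R X Gamma (fun g => T (v g))) => //= [g|x e e0].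
  apply/eqP => Tv0; have : v g = 0 :> c0_sup R Gamma by apply: injT; rewrite linear0.
  move=> /(congr1 (fun u : c0 R Gamma => (\val u : Gamma -> R) g)).
  rewrite raddf0 /= indicE mem_set// => /eqP.
  by rewrite oner_eq0.
apply: contrapT => infA.
pose phi (u : c0_sup R Gamma) : R := (T u : cfun R X) x.
have phiD u w a : phi (u + a *: w) = phi u + a * phi w.
  by rewrite /phi linearD linearZ.
have big n : exists u : c0 R Gamma, [/\ finite_set [set i | u i != 0],
    (forall i, `|u i| <= 1) & n%:R * e <= phi u].
  elim: n => [|n [u [fu u1 nu]]].
    exists 0; split.
    - by apply: sub_finite_set (finite_set0 Gamma) => i /=; rewrite eqxx.
    - by move=> i; rewrite normr0.
    - by rewrite mul0r /phi linear0 cfun0E.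
  have [g [eg /negP]] : exists g, e <= `|phi (v g)| /\ ~ u g != 0.
    exact: infinite_setN0 (infinite_setD infA fu).
  rewrite negbK => /eqP ug.
  pose s := Num.sg (phi (v g)).
  exists (u + s *: v g); split.
  - have : finite_set ([set i | u i != 0] `|` [set g]).
      by rewrite finite_setU; split.
    apply: sub_finite_set => i /=; have [->|ig] := pselect (i = g); first by right.
    rewrite [X in X != 0](_ : _ = u i + s * \1_[set g] i)//.
    by rewrite indicE memNset// mulr0 addr0; left.
  - move=> i; rewrite [X in `|X|](_ : _ = u i + s * \1_[set g] i)// indicE.
    have [->|ig] := pselect (i = g).
      rewrite ug add0r mem_set// mulr1 /s normr_sg.
      by case: (_ != 0).
    by rewrite memNset// mulr0 addr0.
  - rewrite phiD -natr1 mulrDl mul1r lerD// /s -normrEsg//.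
have := (linear_bounded_continuous T).2 cT.
move=> /linear_boundedP => -[M [_ /(_ (Num.max M 0 + 1))]].
rewrite (@le_lt_trans _ _ (Num.max M 0)) ?le_max ?lexx ?ltrDl//.
move=> /(_ isT); set M' := _ + 1 => TM.
have [n] : exists n : nat, M' < n%:R * e.
  exists (Num.truncn (M' / e)).+1; rewrite -ltr_pdivrMr//; exact: truncnS_gt.
have [u [_ u1 nu]] := big n.
have M0 : 0 <= M' by rewrite addr_ge0// le_max lexx orbT.
apply/negP; rewrite -leNgt (le_trans nu)//.
rewrite (le_trans (ler_norm _))// (le_trans (le_sup_norm (T u) x))//.
rewrite (le_trans (TM u))// ler_piMr//.
exact: (sup_norm_le (v := u : c0_sup R Gamma) ler01 u1).
Qed.

End copies_to_compacts.

(** * Bump functions on disjoint open sets *)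

Lemma linear_range_is_copy (R : realType) (E G : topologicalLmodType R)
    (f : {linear G -> E}) (g : E -> G) :
  cancel f g -> continuous f -> {within range f, continuous g} ->
  @is_copy R E G (range f).
Proof.
move=> fK cf cg; split; last by exists f, g.
split=> [|a u v]; rewrite !inE.
  by exists 0; rewrite ?linear0.
by move=> [t _ <-] [s _ <-]; exists (a *: t + s); rewrite ?linearP.
Qed.

(** The index function is part of the data: it records disjointness (a point has
    at most one index) and turns the sum of the functions [t g * bump_fun g] into
    a case distinction. *)
Record bump_family (R : realType) (X : topologicalType) (Gamma : Type) :=
  BumpFamily {
    bump_set : Gamma -> set X;
    bump_center : Gamma -> X;
    bump_fun : Gamma -> X -> R;
    bump_index : X -> option Gamma;
    bump_set_open : forall g, open (bump_set g);
    bump_set_center : forall g, bump_set g (bump_center g);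
    bump_fun_continuous : forall g, continuous (bump_fun g);
    bump_fun_center : forall g, bump_fun g (bump_center g) = 1;
    bump_fun01 : forall g x, 0 <= bump_fun g x <= 1;
    bump_fun_out : forall g x, ~ bump_set g x -> bump_fun g x = 0;
    bump_indexP : forall x g, bump_set g x <-> bump_index x = Some g
  }.

Lemma bump_family_of_disjoint (R : realType) (X : topologicalType)
    (Gamma : Type) (U : Gamma -> set X) :
  compact [set: X] -> hausdorff_space X ->
  (forall g, open (U g)) -> (forall g, U g !=set0) -> trivIset [set: Gamma] U ->
  inhabited (bump_family R X Gamma).
Proof.
move=> cX hX oU U0 tU; have [p Up] := choice U0.
have /choice[f fP] : forall g, exists f : X -> R, [/\ continuous f,
    range f `<=` `[0, 1], f @` (~` U g) `<=` [set 0] & f @` [set p g] `<=` [set 1]].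
  move=> g; apply/uniform_separatorP; apply: (@normal_separatorP R X).1.
  - exact: compact_normal.
  - exact: open_closedC.
  - exact: (accessible_closed_set1 (hausdorff_accessible hX)).
  - by apply/seteqP; split => // x [nUx xp]; apply: nUx; rewrite xp.
have /choice[idx idxP] : forall x, exists o, forall g, U g x <-> o = Some g.
  move=> x; have [[g Ux]|nU] := pselect (exists g, U g x).
    exists (Some g) => g'; split => [Ux'|[<-]//].
    by congr Some; apply: tU => //; exists x.
  by exists None => g; split => // Ux; case: nU; exists g.
constructor; apply: (@BumpFamily R X Gamma U p f idx) => // g.
- by have [] := fP g.
- by have [_ _ _] := fP g; apply; exists (p g).
- move=> x; have [_ f01 _ _] := fP g.
  by have := f01 (f g x); rewrite /= in_itv /=; apply; exists x.
- by move=> x nUx; have [_ _ + _] := fP g; apply; exists x.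
Qed.

Section bumps.
Context (R : realType) (X : topologicalType) (Gamma : Type).
Variable B : bump_family R X Gamma.

Let U := bump_set B.
Let p := bump_center B.
Let f := bump_fun B.
Let idx := bump_index B.
Let oU : forall g, open (U g) := bump_set_open B.
Let Up : forall g, U g (p g) := bump_set_center B.
Let cf : forall g, continuous (f g) := @bump_fun_continuous _ _ _ B.
Let fp : forall g, f g (p g) = 1 := bump_fun_center B.
Let f01 : forall g x, 0 <= f g x <= 1 := bump_fun01 B.
Let f0 : forall g x, ~ U g x -> f g x = 0 := @bump_fun_out _ _ _ B.
Let idxP : forall x g, U g x <-> idx x = Some g := bump_indexP B.

Definition bump_sum (t : Gamma -> R) (x : X) : R :=
  if idx x is Some g then t g * f g x else 0.

Lemma bump_sum_in t g x : U g x -> bump_sum t x = t g * f g x.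
Proof. by move=> /idxP xg; rewrite /bump_sum xg. Qed.

Lemma bump_sum_point t g : bump_sum t (p g) = t g.
Proof. by rewrite (bump_sum_in _ (Up g)) fp mulr1. Qed.

Lemma bump_sum_linear a t u :
  bump_sum (a *: t + u) = a *: bump_sum t + bump_sum u.
Proof.
apply/funext => x; rewrite [RHS](_ : _ = a * bump_sum t x + bump_sum u x)//.
rewrite /bump_sum; case: (idx x) => [g|]; last by rewrite mulr0 addr0.
rewrite [X in X * _](_ : _ = a * t g + u g)//.
by rewrite mulrDl mulrA.
Qed.

Lemma bump_sum_le t x e : 0 <= e -> (forall g, U g x -> `|t g| <= e) ->
  `|bump_sum t x| <= e.
Proof.
move=> e0 te; rewrite /bump_sum; case idx_x: (idx x) => [g|]; last by rewrite normr0.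
have /andP[fg0 fg1] := f01 g x.
by rewrite normrM (ger0_norm fg0) (le_trans (ler_piMr _ fg1))// te//; apply/idxP.
Qed.

(** Near a point outside all the open sets, the finitely many terms with
    [e <= |t g|] are small by continuity and the other ones because [t g] is
    small. *)
Lemma bump_sum_continuous t : t \in @c0_pred R Gamma -> continuous (bump_sum t).
Proof.
rewrite inE /= => t0 x.
have [[g Ux]|nU] := pselect (exists g, U g x).
  rewrite /continuous_at (bump_sum_in _ Ux).
  apply: (@cvg_trans _ ((fun y => t g * f g y) @ x)).
    apply: near_eq_cvg; apply: filterS (open_nbhs_nbhs (conj (oU g) Ux)) => y Uy.
    by rewrite (bump_sum_in _ Uy).
  by apply: cvgM; [exact: cvg_cst|exact: cf].
have tx0 : bump_sum t x = 0.
  rewrite /bump_sum; case idx_x: (idx x) => [g|]//.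
  by case: nU; exists g; apply/idxP.
rewrite /continuous_at tx0; apply/cvgrPdist_le => e e0.
have : nbhs x (\bigcap_(g in [set g | e <= `|t g|]) [set y | `|t g * f g y| < e]).
  apply: filter_bigcap_finite => [|g _]; first exact: t0.
  have : (fun y => t g * f g y) @ x --> t g * f g x.
    by apply: cvgM; [exact: cvg_cst|exact: cf].
  rewrite f0 ?mulr0; last by move=> Ux; apply: nU; exists g.
  by move=> /cvgr0Pnorm_lt/(_ _ e0).
apply: filterS => y ty; rewrite add0r normrN.
rewrite /bump_sum; case idx_y: (idx y) => [g|]; last by rewrite normr0 ltW.
have [etg|tge] := leP e `|t g|; first exact/ltW/ty.
have /andP[fg0 fg1] := f01 g y.
by rewrite normrM (ger0_norm fg0) (le_trans (ler_piMr _ fg1))// ltW.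
Qed.

(** If infinitely many centers satisfy [e <= |h (p g)|], the filter of the sets
    containing all but finitely many of these centers has a cluster point [z] with
    [e <= |h z|].  A fixpoint of [h |-> bump_sum (h \o p)] vanishes outside the
    open sets, so [z] is in some [U g], whose only center is [p g]. *)
Lemma bump_sum_fixpoint_c0 (h : X -> R) : compact [set: X] -> continuous h ->
  h = bump_sum (h \o p) -> (h \o p) \in @c0_pred R Gamma.
Proof.
move=> cX ch hE; rewrite inE => e e0; apply: contrapT.
set A := [set g | _] => infA.
pose F : set_system X := [set S | finite_set (A `&` p @^-1` (~` S))].
have FF : ProperFilter F.
  split; first by rewrite /F /= setC0 preimage_setT setIT.
  split; rewrite /F /=.
  - by rewrite setCT preimage_set0 setI0.
  - move=> S Q FS FQ.
    have : finite_set ((A `&` p @^-1` (~` S)) `|` (A `&` p @^-1` (~` Q))).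
      by rewrite finite_setU.
    apply: sub_finite_set => g [Ag nSQ].
    have [Sp|nS] := pselect (S (p g)); [right|by left].
    by split => // Qp; exact: nSQ.
  - move=> S Q SQ; apply: sub_finite_set => g [Ag nQ]; split => //.
    by move=> /SQ.
have [|z [_ Fz]] := cX F FF.
  by rewrite /F /= setCT preimage_set0 setI0.
have ehz : e <= `|h z|.
  have cl : closed [set x | e <= `|h x|].
    apply: (@preimage_closed _ _ (fun x => `|h x|) [set y : R | e <= y]).
      by move=> x _; apply: cvg_norm; exact: ch.
    exact: closed_ge.
  rewrite closure_id in cl.
  suff : closure [set x | e <= `|h x|] z by rewrite -cl.
  move: Fz; rewrite clusterE; apply; rewrite /F /=.
  by apply: sub_finite_set (finite_set0 Gamma) => g [].
case idx_z: (idx z) => [g|]; last first.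
  by move: ehz; rewrite hE /bump_sum idx_z normr0 leNgt e0.
have Uz : U g z by apply/idxP.
have [||y [[g' [_ g'g] <-] Ug]] :=
    Fz (p @` (A `\` [set g])) (U g).
- apply: sub_finite_set (finite_set1 g) => g' [Ag' /= npg'].
  by apply: contrapT => gg'; apply: npg'; exists g'.
- by apply: open_nbhs_nbhs; split.
by apply: g'g; have := (idxP _ _).1 Ug; rewrite ((idxP _ _).1 (Up g')) => -[].
Qed.

Section into_Cp.
Context (P : {pred Gamma -> R}) (V : subLmodType (in_mem^~ (mem P))).
Hypothesis P_c0 : forall t, t \in P -> t \in @c0_pred R Gamma.

Lemma bump_map_subproof (v : V) : bump_sum (\val v) \in @continuous_pred R X.
Proof. by rewrite inE; apply: bump_sum_continuous; apply: P_c0; exact: valP. Qed.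

Definition bump_map (v : V) : cfun R X := CFun (bump_map_subproof v).

(** The default value is only taken on functions outside the range of
    [bump_map], where the inverse of a copy is arbitrary. *)
Definition sample (h : cfun R X) : V := insubd 0 (h \o p).

Lemma bump_mapK : cancel bump_map sample.
Proof.
move=> v; rewrite /sample (_ : bump_map v \o p = \val v); first exact: valKd.
by apply/funext => g /=; rewrite bump_sum_point.
Qed.

Lemma bump_map_linear : linear bump_map.
Proof.
move=> a v w; apply: val_inj.
by rewrite linearP /= -bump_sum_linear linearP.
Qed.

Definition bump_map_p : {linear pointwise V -> Cp R X} :=
  HB.pack (bump_map : pointwise V -> Cp R X)
    (GRing.isLinear.Build R (pointwise V) (Cp R X) *:%R _ bump_map_linear).

Lemma bump_map_p_is_copy : @is_copy R (Cp R X) (pointwise V) (range bump_map_p).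
Proof.
apply: (@linear_range_is_copy R (Cp R X) (pointwise V)
    bump_map_p sample); first exact: bump_mapK.
  apply: continuous_to_pointwise => x /=; rewrite /bump_sum.
  case: (idx x) => [g|] v; last exact: (@cst_continuous (pointwise V) R).
  apply: (@continuous_comp (pointwise V) R R
    (fun v => (\val v : Gamma -> R) g) (fun y => y * f g x)).
    exact: pointwise_eval_continuous.
  by apply: cvgM; [exact: cvg_id|exact: cvg_cst].
have bgE g v : bump_map v (p g) = (\val (sample (bump_map v)) : Gamma -> R) g.
  by rewrite bump_mapK /= bump_sum_point.
apply: (@continuous_to_pointwise _ _ _ V (subspace (range bump_map_p))) => g.
apply: (@subspace_eq_continuous _ _ _ (fun h : Cp R X => (h : cfun R X) (p g))).
  move=> h; rewrite inE => -[v _ <-].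
  exact: bgE.
by apply: continuous_subspaceT => h; exact: Cp_eval_continuous.
Qed.

(** This describes the range by conditions that are closed for the pointwise
    topology; that the coefficients [h \o p] are then in [c_0] is
    [bump_sum_fixpoint_c0]. *)
Lemma range_bump_map_p : compact [set: X] ->
  (forall t, t \in @c0_pred R Gamma -> t \in P) ->
  range bump_map_p = \bigcap_x [set h : Cp R X |
    (h : cfun R X) x = bump_sum ((h : cfun R X) \o p) x].
Proof.
move=> cX c0_P; apply/seteqP; split => [_ [v _ <-] x _ /=|h hE].
  by congr bump_sum; apply/funext => g /=; rewrite bump_sum_point.
have {}hE : cfun_val h = bump_sum (cfun_val h \o p).
  by apply/funext => x; exact: hE.
have hP := c0_P _ (bump_sum_fixpoint_c0 cX (@cfun_continuous R X h) hE).
exists (Sub (cfun_val h \o p) hP : V) => //.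
by apply: val_inj; rewrite /= SubK.
Qed.

Lemma range_bump_map_p_closed : compact [set: X] ->
  (forall t, t \in @c0_pred R Gamma -> t \in P) ->
  closed (range bump_map_p).
Proof.
move=> cX c0_P; rewrite range_bump_map_p//; apply: closed_bigI => x _.
pose d (h : Cp R X) : R := (h : cfun R X) x - bump_sum ((h : cfun R X) \o p) x.
have cd : continuous d.
  rewrite /d /bump_sum; case: (idx x) => [g|] h.
    apply: (@continuousB _ R^o (Cp R X) (fun h => (h : cfun R X) x)
      (fun h => (h : cfun R X) (p g) * f g x)).
      exact: Cp_eval_continuous.
    apply: (@continuousM _ (Cp R X) (fun h => (h : cfun R X) (p g)) (cst (f g x))).
      exact: Cp_eval_continuous.
    exact: (@cst_continuous (Cp R X) R).
  apply: (@continuousB _ R^o (Cp R X) (fun h => (h : cfun R X) x) (cst 0)).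
    exact: Cp_eval_continuous.
  exact: (@cst_continuous (Cp R X) R).
have -> : [set h : Cp R X | (h : cfun R X) x = bump_sum ((h : cfun R X) \o p) x] =
    d @^-1` [set 0].
  apply/seteqP; split => h /= hx; first by rewrite /d hx subrr.
  by apply/eqP; rewrite -subr_eq0; apply/eqP.
exact: ((continuous_closedP d).1 cd _ (@closed_eq R 0)).
Qed.

End into_Cp.

End bumps.

Lemma isometry_is_copy (R : realType) (E G : normedModType R)
    (T : {linear G -> E}) (g : E -> G) :
  cancel T g -> (forall v, `|T v| = `|v|) -> @is_copy R E G (range T).
Proof.
move=> TK Tn; apply: (@linear_range_is_copy R E G T g) => //.
  move=> v; apply/cvgrPdist_le => e e0.
  have /cvgrPdist_le/(_ _ e0) := @cvg_id _ (nbhs v).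
  by apply: filterS => w; rewrite -linearB Tn.
apply/subspace_continuousP => _ [v _ <-]; rewrite /from_subspace TK.
apply/cvgrPdist_le => e e0.
have /cvgrPdist_le/(_ _ e0) := @cvg_id _ (nbhs (T v)).
by apply: filterS => y + [w _ wy] /=; rewrite -wy TK -linearB Tn.
Qed.

Section bumps_sup.
Context (R : realType) (X : topologicalType) (cX : compact [set: X]).
Context (Gamma : Type) (B : bump_family R X Gamma).

Let c0_c0 (t : Gamma -> R) (tP : t \in @c0_pred R Gamma) := tP.

Definition bump_map_sup : {linear c0_sup R Gamma -> C_sup R cX} :=
  HB.pack (bump_map B c0_c0 : c0_sup R Gamma -> C_sup R cX)
    (GRing.isLinear.Build R (c0_sup R Gamma) (C_sup R cX) *:%R _
       (@bump_map_linear _ _ _ B _ (c0 R Gamma) c0_c0)).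

Lemma bump_map_sup_is_copy :
  @is_copy R (C_sup R cX) (c0_sup R Gamma) (range bump_map_sup).
Proof.
apply: (@isometry_is_copy R (C_sup R cX) (c0_sup R Gamma) bump_map_sup
  (sample B (c0 R Gamma))); first exact: bump_mapK.
move=> v; apply/eqP; rewrite eq_le; apply/andP; split.
  apply: (sup_norm_le (v := bump_map_sup v)) => // x.
  by apply: bump_sum_le => // g _; exact: (le_sup_norm v g).
apply: (sup_norm_le (v := v)) => // g.
have := le_sup_norm (bump_map_sup v) (bump_center B g).
by rewrite /= bump_sum_point.
Qed.

End bumps_sup.

(** * The equivalence *)

Theorem theorem5 (R : realType) (X : topologicalType)
    (cX : compact [set: X]) (hX : hausdorff_space X) :
  [<-> exists F : set (set X),
         [/\ uncountable F, F `<=` open & trivIset F id];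
       exists Gamma : Type, uncountable [set: Gamma] /\
         contains_copy (Cp R X) (c00_p R Gamma);
       exists Gamma : Type, uncountable [set: Gamma] /\
         contains_closed_copy (Cp R X) (c0_p R Gamma);
       exists Gamma : Type, uncountable [set: Gamma] /\
         contains_copy (C_sup R cX) (c0_sup R Gamma);
       exists K : set (Cp R X), compact K /\ ~ separable_set K].
Proof.
have c00_c0 (Gamma : Type) (t : Gamma -> R) :
    t \in @c00_pred R Gamma -> t \in @c0_pred R Gamma.
  rewrite !inE /= => t0 e e0; apply: sub_finite_set t0 => i /= et.
  by rewrite -normr_gt0 (lt_le_trans e0).
have bumps : (exists F : set (set X),
      [/\ uncountable F, F `<=` open & trivIset F id]) ->
    exists Gamma : Type, uncountable [set: Gamma] /\
      inhabited (bump_family R X Gamma).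
  move=> [F [ucF Fo tF]].
  (* the empty set may belong to F but has no center *)
  pose F' := F `\ set0.
  exists (set_type F'); split.
    rewrite /uncountable (eq_countable (card_setT F')) => cF'; apply: ucF.
    apply: (sub_countable (B := F' `|` [set set0])).
      apply: subset_card_le => V FV.
      by have [->|V0] := pselect (V = set0); [right|left].
    by rewrite -bigcup2E; apply: bigcup_countable => // -[|[|n]] _ /=.
  apply: (@bump_family_of_disjoint R X (set_type F') (fun V => \val V)) => //.
  - by move=> V; have [/Fo] := set_valP V.
  - by move=> V; have [_ /eqP/set0P] := set_valP V.
  - move=> V W _ _ VW; apply: val_inj; apply: tF => //.
      by have [] := set_valP V.
    by have [] := set_valP W.
have ccc_fails : (exists K : set (Cp R X), compact K /\ ~ separable_set K) ->
    exists F : set (set X), [/\ uncountable F, F `<=` open & trivIset F id].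
  move=> [K [cK nsK]]; apply: contrapT => ccc; apply: nsK.
  have [|D cD Dsep] := ccc_countable_separating cK cX hX.
    by move=> F Fo tF; apply: contrapT => ucF; apply: ccc; exists F.
  exact: (countable_separating_separable cK cD).
have c00_copy : (exists Gamma : Type, uncountable [set: Gamma] /\
      contains_copy (Cp R X) (c00_p R Gamma)) ->
    exists K : set (Cp R X), compact K /\ ~ separable_set K.
  move=> [Gamma [ucG [S [_ [T [g [_ TK cT _]]]]]]].
  apply: (pointwise_copy_compact ucG _ (can_inj TK) cT).
  exact: indic1_c00.
have c0_copy : (exists Gamma : Type, uncountable [set: Gamma] /\
      contains_closed_copy (Cp R X) (c0_p R Gamma)) ->
    exists K : set (Cp R X), compact K /\ ~ separable_set K.
  move=> [Gamma [ucG [S [_ [_ [T [g [_ TK cT _]]]]]]]].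
  apply: (pointwise_copy_compact ucG _ (can_inj TK) cT).
  exact: indic1_c0.
tfae.
- move=> /bumps[Gamma [ucG [B]]]; exists Gamma; split => //.
  exists (range (@bump_map_p R X Gamma B _ (c00 R Gamma) (c00_c0 Gamma))).
  exact: bump_map_p_is_copy.
- move=> /c00_copy/ccc_fails/bumps[Gamma [ucG [B]]]; exists Gamma; split => //.
  exists (range (@bump_map_p R X Gamma B _ (c0 R Gamma) (fun=> id))).
  split; first exact: range_bump_map_p_closed.
  exact: bump_map_p_is_copy.
- move=> /c0_copy/ccc_fails/bumps[Gamma [ucG [B]]]; exists Gamma; split => //.
  exists (range (bump_map_sup cX B)); exact: bump_map_sup_is_copy.
- move=> [Gamma [ucG [S [_ [T [g [_ TK cT _]]]]]]].
  exact: (sup_copy_compact ucG (can_inj TK) cT).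
- exact: ccc_fails.
Qed.
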